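(* Let $\tilde\sigma^2=\sigma^2\|T_c^\top d\|_2^2$ and consider the two hypotheses on an observed sample $X\in\mathbb{Z}_q$: $$\mathcal{H}_0:\ X\sim\mathcal{N}_{\mathbb{Z}_q}(0,\tilde\sigma^2),\qquad \mathcal{H}_1:\ X\sim\mathcal{U}_q .$$ Let $\beta$ be the Type II Error probability of the test that rejects $\mathcal{H}_0$ in favor of $\mathcal{H}_1$ when $|X|\ge\gamma$, where $\gamma$ is such that the Type I Error probability is $\alpha$, i.e. $\Pr(|Y|\ge\gamma)=\alpha$ for $Y\sim\mathcal{N}_{\mathbb{Z}_q}(0,\tilde\sigma^2)$. Then $$\beta^2\le-\frac{4\tilde\sigma^2}{a q^2}\log\left(1-(1-\alpha)^2\left(1-e^{-\frac{bQ^2}{4\tilde\sigma^2}}\right)\right),$$ where $a=\frac12$, $b=\frac{2}{\pi}$, and $Q=2\left(\frac{q-1}{2}\right)^2(v+l)+1$ for some constant $l\ge1$. In particular, the resulting upper bound on $\beta$ (the square root of the right-hand side) increases sublinearly as a function of $\tilde\sigma^2$, i.e. it is increasing in $\tilde\sigma^2$ and its ratio to $\tilde\sigma^2$ tends to $0$ as $\tilde\sigma^2\to\infty$.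
   Context: Notation: $\mathbb{Z}_q=\{i\in\mathbb{Z}: -q/2\le i<q/2\}$; $a\bmod q=a-\lfloor (a+q/2)/q\rfloor q\in\mathbb{Z}_q$, entrywise for vectors and matrices. $\mathcal{U}_q$ is the uniform distribution on $\mathbb{Z}_q$. For a support set $\mathcal{S}$, the discrete normal $\mathcal{N}_{\mathcal{S}}(\mu,\sigma^2)$ is the distribution on $\mathcal{S}$ with $\Pr(X=x)=e^{-(x-\mu)^2/(2\sigma^2)}/\sum_{y\in\mathcal{S}}e^{-(y-\mu)^2/(2\sigma^2)}$. The modulus $q$ is taken prime and odd. Origin of the quantities: LWE encryption with secret $s\in\mathbb{Z}_q^v$ (so $v$ is the dimension of the secret vector) and scaling $r>0$ encrypts an integer message vector $m$ as $(P,\,Ps+mr+e\bmod q)$, with entries of $P,s$ sampled from $\mathcal{U}_q$ and entries of $e$ independent $\mathcal{N}_{\mathbb{Z}_q}(0,\sigma^2)$. The stacked encrypted residuals are $\rho^e=(P^\rho,\,P^\rho s+r\rho+e^\rho)\bmod q$, where $e^\rho=T_ce$ for a fixed integer matrix $T_c$ describing the integer linear operations of the controller. A filtering vector is a nonzero vector $d$ with entries in $\mathbb{Z}_q$ and $d^\top P^\rho=0\bmod q$; then $d^\top\rho^e\bmod q=(0,X)$, where $X=(r\,d^\top\rho+d^\top e^\rho)\bmod q$ is the sample being tested. The constant $l$ is such that $d$ has $v+l$ nonzero entries ($l$ being the number of basis filtering vectors combined to form $d$). The Type I Error is the probability of rejecting $\mathcal{H}_0$ when $\mathcal{H}_0$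 holds; the Type II Error is the probability of not rejecting $\mathcal{H}_0$ when $\mathcal{H}_1$ holds. Standing assumption on the noise variance: for some $0<\epsilon<1$, $\frac{q^2}{4}\frac{\Omega_\epsilon^2}{\|T_c^\top d\|_2^2}>\sigma^2>\|T_c^\top d\|_2^2\,\eta_\epsilon^2(\mathbb{L})$, where $\eta_\epsilon(\mathbb{L})$ is the smoothing parameter of the lattice $\mathbb{L}$ underlying the error distribution (integer-valued errors, $\mathbb{L}=\mathbb{Z}$) and $\Omega_\epsilon<1$ is chosen so that $\Pr(\|T_c^\top d\|_2|Z|>q/2)\le\mathcal{O}(\epsilon)$ for $Z\sim\mathcal{N}_{\mathbb{Z}_q}(0,\sigma^2)$. *)

(* Defs.v *)
From HB Require Import structures.
From mathcomp Require Import all_boot all_order all_algebra.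
From mathcomp Require Import all_classical all_reals all_analysis.

Set Implicit Arguments.
Unset Strict Implicit.
Unset Printing Implicit Defensive.

Import Order.TTheory GRing.Theory Num.Theory.
Import numFieldNormedType.Exports.

Local Open Scope classical_set_scope.
Local Open Scope ring_scope.

(* Representatives -q/2 <= i < q/2, with denominators cleared. *)
Definition Zq (q : nat) : set int := [set i : int | - q%:Z <= 2 * i < q%:Z].

Section Laws.
Variable R : realType.

Definition gauss_weight (mu s2 x : R) : R := expR (- ((x - mu) ^+ 2 / (2 * s2))).

(* Mass function on int of the discrete normal on the support S, with mean
   parameter mu and variance parameter s2; the normalising sum may be
   infinite. *)
Definition discrete_normal (S : set int) (mu s2 : R) (x : int) : R :=
  if x \in S then
    gauss_weight mu s2 x%:~R /
      fine (\esum_(y in S) (gauss_weight mu s2 y%:~R)%:E)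
  else 0.

(* Zq q has q elements. *)
Definition uniform_Zq (q : nat) (x : int) : R :=
  if x \in Zq q then q%:R^-1 else 0.

(* X ~ p, where p is a mass function on the integers.  When p has total mass 1
   this forces X to be almost surely integer-valued, with values in the
   support of p. *)
Definition has_law d (T : measurableType d) (P : probability T R)
    (X : {RV P >-> R}) (p : int -> R) : Prop :=
  forall x : int, pmf X x%:~R = p x.

Definition norm2 n (u : 'cV[int]_n) : R :=
  Num.sqrt (\sum_(i < n) ((u i 0)%:~R : R) ^+ 2).

Definition Zlattice : set R := range (fun z : int => z%:~R : R).

Definition dual_lattice (L : set R) : set R :=
  [set y | forall x, L x -> Zlattice (x * y)].

(* rho_{1/s}(L^* \ {0}), with rho_t(y) = exp(- pi y^2 / t^2). *)
Definition dual_gauss_mass (L : set R) (s : R) : \bar R :=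
  \esum_(y in dual_lattice L `\ 0) (expR (- (pi * (s * y) ^+ 2)))%:E.

(* For a lattice L of rank one and eps > 0 the infimum is a minimum. *)
Definition smoothing_param (L : set R) (eps : R) : R :=
  inf [set s : R | 0 < s /\ (dual_gauss_mass L s <= eps%:E)%E].

Definition filtering_vector (q n v : nat) (P : 'M[int]_(n, v))
    (d : 'cV[int]_n) : Prop :=
  [/\ d != 0, forall i, Zq q (d i 0) &
      forall j : 'I_v, ((d^T *m P)%R ord0 j = 0 %[mod q%:Z])%Z].

(* Pr(c |Z| > q/2) for Z ~ N_{Zq q}(0, s2). *)
Definition wrap_probability (q : nat) (c s2 : R) : \bar R :=
  \esum_(z in [set z : int | Zq q z /\ q%:R / 2 < c * `|z%:~R|])
     (discrete_normal (Zq q) 0 s2 z)%:E.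

Definition variance_upper (q : nat) (c : R) (Om : R -> R) (eps : R) : R :=
  q%:R ^+ 2 / 4 * (Om eps ^+ 2 / c ^+ 2).

(* Om_eps < 1 is such that the upper bound on the variance keeps the wrap
   probability O(eps), with a constant uniform in eps and in the variance. *)
Definition wrap_threshold (q : nat) (c : R) (Om : R -> R) : Prop :=
  (forall eps, 0 < eps < 1 -> 0 < Om eps < 1) /\
  exists C : R, forall eps s2 : R, 0 < eps < 1 ->
    0 < s2 < variance_upper q c Om eps ->
    (wrap_probability q c s2 <= (C * eps)%:E)%E.

Definition noise_variance_assumption (q : nat) (c : R) (Om : R -> R)
    (s2 : R) : Prop :=
  wrap_threshold q c Om /\
  exists2 eps : R, 0 < eps < 1 &
    c ^+ 2 * smoothing_param Zlattice eps ^+ 2 < s2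
      < variance_upper q c Om eps.

Definition const_a : R := 1 / 2.
Definition const_b : R := 2 / pi.

Definition const_Q (q v l : nat) : R :=
  2 * ((q%:R - 1) / 2) ^+ 2 * (v + l)%:R + 1.

(* Upper bound on the squared Type II error; t is the variance parameter of
   the null hypothesis. *)
Definition typeII_sq_bound (q v l : nat) (alpha t : R) : R :=
  - (4 * t / (const_a * q%:R ^+ 2)) *
    ln (1 - (1 - alpha) ^+ 2 *
              (1 - expR (- (const_b * const_Q q v l ^+ 2 / (4 * t))))).

Definition typeII_bound (q v l : nat) (alpha t : R) : R :=
  Num.sqrt (typeII_sq_bound q v l alpha t).

End Laws.

Arguments Zlattice {R}.
Arguments uniform_Zq {R} q x.
Arguments norm2 {R n} u.

(* Main.v *)
(* Write q = 2 m + 1, delta = 1 / sqrt (2 tsigma2) and let S_j be the sum of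
   exp (- (k delta)^2) over |k| <= j. Unless gamma <= 0 (then beta = 0 and
   alpha = 1), the acceptance region is {|k| <= j} for some j <= m, so that
   beta = (2 j + 1) / q and 1 - alpha = S_j / S_m. Let F be the odd primitive of
   exp (- x^2) and c_j = (j + 1/2) delta. The integral of exp (- x^2) over the
   cell of width delta around k delta, divided by the value at the centre, is
   nondecreasing in |k|, hence S_j / F(c_j) is nonincreasing in j. Moreover
   F(c)^2 / (1 - exp (- c^2)) is nonincreasing in c > 0. Together,
     (S_j / S_m)^2 (1 - exp (- c_m^2)) >= 1 - exp (- c_j^2),
   which is the bound on beta, because Q >= q and pi <= 4.
   The bound depends on t = tsigma2 as - t ln (1 - u + u exp (- B / t)), and
   y |-> - ln (1 - u + u exp (- y)) is concave and vanishes at 0, whence the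
   monotonicity; this function is also at most y, so the squared bound stays
   bounded as t tends to infinity. *)

Require Import Defs.
From HB Require Import structures.
From mathcomp Require Import all_boot all_order all_algebra.
From mathcomp Require Import all_classical all_reals all_analysis.
From mathcomp Require Import zify ring lra.

Set Implicit Arguments.
Unset Strict Implicit.
Unset Printing Implicit Defensive.

Import Order.TTheory GRing.Theory Num.Theory.
Import numFieldNormedType.Exports.

Local Open Scope classical_set_scope.
Local Open Scope ring_scope.

(** * Monotonicity from derivatives, and an odd primitive of the Gaussian *)

Lemma is_derive_le (R : realType) (f df : R -> R) (a b : R) : a <= b ->
  (forall x, a <= x <= b -> is_derive x 1 f (df x)) ->
  (forall x, a <= x <= b -> 0 <= df x) -> f a <= f b.
Proof.
move=> ab fdf df0.
have cf : {within `[a, b], continuous f}.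
  apply: derivable_within_continuous => x; rewrite in_itv /= => /fdf ?.
  exact: ex_derive.
have [x|c cab fab] := MVT_segment (df := df) ab _ cf.
  by rewrite in_itv /= => /andP[ax xb]; apply: fdf; rewrite !ltW.
by rewrite -subr_ge0 fab mulr_ge0 ?subr_ge0 // df0.
Qed.

Lemma is_derive_gauss_fun (R : realType) (x : R) :
  is_derive x 1 (gauss_fun) (- (2 * x) * gauss_fun x).
Proof.
rewrite /gauss_fun; apply: (is_derive_eq _ _).
rewrite /GRing.scale /=; ring.
Qed.

Lemma is_derive1_oppr (R : realType) (f : R -> R) (x df : R) :
  is_derive (- x) 1 f df -> is_derive x 1 (fun y => f (- y)) (- df).
Proof.
move=> fdf; rewrite -mulrN1.
exact: (is_derive1_comp (f := f) (g := -%R)).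
Qed.

Lemma gauss_funN (R : realType) (x : R) : gauss_fun (- x) = gauss_fun x.
Proof. by rewrite /gauss_fun sqrrN. Qed.

(** The integral from minus infinity is a primitive by the fundamental theorem of calculus. Its odd
    part is still one, because the Gaussian is even. *)
Lemma gauss_primitive (R : realType) :
  exists2 F : R -> R, forall x : R, is_derive x 1 F (gauss_fun x) &
    forall x, F (- x) = - F x.
Proof.
pose G (x : R) : R :=
  (\int[lebesgue_measure]_(t in `]-oo, x]) (gauss_fun t))%R.
have dG (x : R) : is_derive x 1 G (gauss_fun x).
  have iG : lebesgue_measure.-integrable `]-oo, x + 1]
      (EFin \o gauss_fun).
    exact: integrableS integrableT_gauss.
  have x1 : x < x + 1 by rewrite ltrDl.
  have [|dGx <-] := continuous_FTC1 x1 iG (ltNyr x) _.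
    exact: continuous_gauss_fun.
  by rewrite derive1E; exact: derivableP.
exists (fun x => 2^-1 * (G x - G (- x))) => x; last by rewrite opprK; ring.
have dGN : is_derive x 1 (fun y => G (- y)) (- gauss_fun x).
  by apply: is_derive1_oppr; rewrite -gauss_funN.
apply: (is_derive_eq _ _).
by rewrite /GRing.scale /=; field.
Qed.

(** * Inequalities between the Gaussian and its primitive *)

Section GaussWindow.
Variables (R : realType) (F : R -> R).
Hypothesis dF : forall x : R, is_derive x 1 F (gauss_fun x).
Hypothesis FN : forall x, F (- x) = - F x.

Lemma primitive0 : F 0 = 0.
Proof. by have := FN 0; rewrite oppr0; lra. Qed.

Lemma is_derive_shift (a r : R) :
  is_derive r 1 (fun y => F (a + y) - F (a - y))
    (gauss_fun (a + r) + gauss_fun (a - r)).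
Proof.
have dp : is_derive r 1 (fun y => F (a + y)) (gauss_fun (a + r)).
  have dg : is_derive r 1 (cst a + id) (1 : R).
    by apply: is_derive_eq; rewrite add0r.
  rewrite -[gauss_fun _]mulr1.
  exact: (is_derive1_comp (f := F) (g := cst a + id)).
have dm : is_derive r 1 (fun y => F (a - y)) (- gauss_fun (a - r)).
  have dg : is_derive r 1 (cst a - id) (-1 : R).
    by apply: is_derive_eq; rewrite sub0r.
  rewrite -mulrN1.
  exact: (is_derive1_comp (f := F) (g := cst a - id)).
by apply: (is_derive_eq _ _); rewrite opprK.
Qed.

(* In the window variable r, the difference of the two sides has derivative
   2 exp(-(a^2 + b^2 + r^2)) (cosh (2 b r) - cosh (2 a r)). *)
Lemma gauss_window_le (a b r : R) : 0 <= a -> a <= b -> 0 <= r ->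
  gauss_fun b * (F (a + r) - F (a - r)) <=
  gauss_fun a * (F (b + r) - F (b - r)).
Proof.
move=> a0 ab r0; rewrite -subr_ge0.
pose f y := gauss_fun a * (F (b + y) - F (b - y)) -
            gauss_fun b * (F (a + y) - F (a - y)).
have -> : 0 = f 0 by rewrite /f !addr0 !subr0 !subrr !mulr0 subr0.
apply: (@is_derive_le _ f (fun y =>
  gauss_fun a * (gauss_fun (b + y) + gauss_fun (b - y)) -
  gauss_fun b * (gauss_fun (a + y) + gauss_fun (a - y)))) => // y /andP[y0 _].
  have da := is_derive_shift a y.
  have db := is_derive_shift b y.
  by apply: (is_derive_eq _ _).
(* The difference of hyperbolic cosines factors; both factors are nonnegative since [b - a], [b + a]
   and [y] are. *)
have -> : gauss_fun a * (gauss_fun (b + y) + gauss_fun (b - y)) -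
  gauss_fun b * (gauss_fun (a + y) + gauss_fun (a - y)) =
  expR (- (a ^+ 2 + b ^+ 2 + y ^+ 2 + 2 * b * y)) *
  ((expR (2 * (b - a) * y) - 1) * (expR (2 * (b + a) * y) - 1)).
  set K := expR (- (a ^+ 2 + _ + _ + _)).
  set P := expR (2 * (b - a) * y); set Q := expR (2 * (b + a) * y).
  have -> : (P - 1) * (Q - 1) = P * Q - P - Q + 1 by ring.
  have -> : K * (P * Q - P - Q + 1) =
    (K + K * P * Q) - (K * P + K * Q) by ring.
  rewrite !mulrDr /gauss_fun /K /P /Q -!expRD.
  by congr (expR _ + expR _ - (expR _ + expR _)); ring.
rewrite mulr_ge0 ?expR_ge0 // mulr_ge0 // subr_ge0 -[leLHS]expR0 ler_expR.
  by rewrite mulr_ge0 // mulr_ge0 // subr_ge0.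
by rewrite mulr_ge0 // mulr_ge0 // addr_ge0 // (le_trans a0).
Qed.

(** On [[0, x]] the Gaussian is at least its value at the right end. *)
Lemma primitive_ge (x : R) : 0 <= x -> x * gauss_fun x <= F x.
Proof.
move=> x0; rewrite -subr_ge0.
pose f y := F y - y * gauss_fun y.
have -> : 0 = f 0 by rewrite /f primitive0 mul0r subrr.
apply: (@is_derive_le _ f (fun y => 2 * y ^+ 2 * gauss_fun y)) => //.
  move=> y _; have dg := is_derive_gauss_fun y.
  apply: (is_derive_eq _ _); rewrite /GRing.scale /=; ring.
by move=> y _; rewrite mulr_ge0 ?gauss_fun_ge0 // mulr_ge0 // sqr_ge0.
Qed.

(** The difference of the two sides vanishes at 0 and has derivative [F y - y * gauss_fun y],
    nonnegative by [primitive_ge]. *)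
Lemma one_sub_gauss_fun_le (x : R) : 0 <= x -> 1 - gauss_fun x <= x * F x.
Proof.
move=> x0; rewrite -subr_ge0.
pose f y := y * F y - (1 - gauss_fun y).
have -> : 0 = f 0 by rewrite /f /gauss_fun expr0n oppr0 expR0; ring.
apply: (@is_derive_le _ f (fun y => F y - y * gauss_fun y)) => //.
  move=> y _; have dg := is_derive_gauss_fun y.
  apply: (is_derive_eq _ _); rewrite /GRing.scale /=; ring.
by move=> y /andP[y0 _]; rewrite subr_ge0 primitive_ge.
Qed.

Lemma gauss_fun_lt1 (x : R) : 0 < x -> gauss_fun x < 1.
Proof. by move=> x0; rewrite /gauss_fun expR_lt1 oppr_lt0 exprn_gt0. Qed.

Lemma primitive_gt0 (x : R) : 0 < x -> 0 < F x.
Proof.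
move=> x0; apply: lt_le_trans (primitive_ge (ltW x0)).
by rewrite mulr_gt0 // expR_gt0.
Qed.

(** The derivative of [F ^+ 2 / (1 - gauss_fun)] has the sign of [1 - gauss_fun z - z * F z], which
    [one_sub_gauss_fun_le] makes nonpositive. *)
Lemma primitive_sqr_ratio_le (x y : R) : 0 < x -> x <= y ->
  F y ^+ 2 * (1 - gauss_fun x) <= F x ^+ 2 * (1 - gauss_fun y).
Proof.
move=> x0 xy.
have D0 z : x <= z -> 0 < 1 - gauss_fun z.
  by move=> xz; rewrite subr_gt0 gauss_fun_lt1 // (lt_le_trans x0).
rewrite -ler_pdivlMr ?D0 // mulrAC -ler_pdivrMr ?D0 //.
rewrite -lerN2.
pose f z := - (F z ^+ 2 * (1 - gauss_fun z)^-1).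
rewrite -/(f x) -/(f y).
apply: (@is_derive_le _ f (fun z => 2 * F z * gauss_fun z *
  (z * F z - (1 - gauss_fun z)) / (1 - gauss_fun z) ^+ 2)) => //.
  move=> z /andP[xz _].
  have dg := is_derive_gauss_fun z.
  have dD : is_derive z 1 (fun z => 1 - gauss_fun z) (2 * z * gauss_fun z).
    by apply: (is_derive_eq _ _); ring.
  have dV := is_deriveV (f := fun z => 1 - gauss_fun z)
    (lt0r_neq0 (D0 z xz)) dD.
  apply: (is_derive_eq _ _); rewrite /GRing.scale /=; field.
  by rewrite lt0r_neq0 // D0.
move=> z /andP[xz _]; have z0 : 0 <= z by rewrite ltW // (lt_le_trans x0).
rewrite divr_ge0 ?sqr_ge0 // mulr_ge0 ?subr_ge0 ?one_sub_gauss_fun_le //.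
rewrite mulr_ge0 ?gauss_fun_ge0 // mulr_ge0 // ltW // primitive_gt0 //.
exact: lt_le_trans xz.
Qed.

End GaussWindow.

(** * Symmetric integer intervals *)

Definition int_ball (j : nat) : set int := [set x : int | (`|x| <= j)%N].

Lemma int_ball0 : int_ball 0 = [set 0].
Proof.
by apply/seteqP; split=> x; rewrite /int_ball /= leqn0 absz_eq0 => /eqP.
Qed.

Lemma int_ballS (j : nat) :
  int_ball j.+1 = int_ball j `|` ([set j.+1%:Z] `|` [set - j.+1%:Z]).
Proof.
apply/seteqP; split=> x; rewrite /int_ball /=; last first.
  by case=> [|[->|->]] //; lia.
rewrite leq_eqVlt => /orP[/eqP xj|]; last by left.
by case: (ltrP x 0) => x0; right; [right|left]; lia.
Qed.

Lemma finite_int_ball (j : nat) : finite_set (int_ball j).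
Proof.
elim: j => [|j IHj]; first by rewrite int_ball0; exact: finite_set1.
by rewrite int_ballS finite_setU.
Qed.

Lemma fsbig_int_ballS (V : nmodType) (f : int -> V) (j : nat) :
  \sum_(x \in int_ball j.+1) f x =
  \sum_(x \in int_ball j) f x + (f j.+1%:Z + f (- j.+1%:Z)).
Proof.
rewrite int_ballS fsbigU0 ?fsbigU0 ?fsbig_set1 //.
- by move=> x [/= -> ]; lia.
- exact: finite_int_ball.
- by move=> x /= [xj [xE|xE]]; move: xj; rewrite xE /int_ball /=; lia.
Qed.

Lemma card_int_ball (R : pzSemiRingType) (j : nat) :
  \sum_(x \in int_ball j) (1 : R) = (2 * j + 1)%:R.
Proof.
elim: j => [|j IHj]; first by rewrite int_ball0 fsbig_set1.
by rewrite fsbig_int_ballS IHj -[1 + 1]/(2%:R) -natrD; congr _%:R; lia.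
Qed.

(** A positive threshold accepts 0. When the radius grows to [m.+1], either every point is accepted
    or the two new points are both rejected. *)
Lemma int_ball_lt_real (R : realType) (m : nat) (g : R) : 0 < g ->
  exists2 j : nat, (j <= m)%N &
    int_ball m `&` [set x : int | `|x%:~R| < g] = int_ball j.
Proof.
move=> g0; elim: m => [|m [j jm IHm]].
  exists 0%N => //; rewrite int_ball0; apply/seteqP; split=> x /= => [[]|->] //.
  by split; rewrite // normr0.
have [mg|gm] := ltrP m.+1%:R g.
  exists m.+1 => //; apply: setIidl => x; rewrite /int_ball /= => xm.
  apply: le_lt_trans mg.
  by rewrite -intr_norm -natr_absz ler_nat.
exists j; first exact: leqW.
rewrite -IHm; apply/seteqP; split=> x; rewrite /int_ball /= => -[xm xg].
  split=> //; rewrite -ltnS ltn_neqAle xm andbT.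
  apply: contraTN xg => /eqP xE; rewrite -leNgt.
  by rewrite -intr_norm -natr_absz xE.
by split=> //; exact: leqW.
Qed.

(** * Gaussian sums compared with Gaussian integrals *)

Definition gauss_sum (R : realType) (delta : R) (j : nat) : R :=
  \sum_(x \in int_ball j) gauss_fun (x%:~R * delta).

Section GaussSum.
Variables (R : realType) (F : R -> R).
Hypothesis dF : forall x : R, is_derive x 1 F (gauss_fun x).
Hypothesis FN : forall x, F (- x) = - F x.
Variable delta : R.
Hypothesis delta_gt0 : 0 < delta.

Local Notation S := (gauss_sum delta).
(** Right end of the cell of width [delta] centred at [j * delta]; the cells with [|k| <= j] tile
    [[- c j, c j]]. *)
Let c (j : nat) : R := (j%:R + 2^-1) * delta.

Let SS j : S j.+1 = S j + 2 * gauss_fun (j.+1%:R * delta).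
Proof.
by rewrite /gauss_sum fsbig_int_ballS rmorphN /= mulNr gauss_funN; ring.
Qed.

Let S0 : S 0 = 1.
Proof.
by rewrite /gauss_sum int_ball0 fsbig_set1 mul0r /gauss_fun expr0n oppr0 expR0.
Qed.

Lemma gauss_sum_gt0 j : 0 < S j.
Proof.
elim: j => [|j IHj]; first by rewrite S0.
by rewrite SS addr_gt0 // mulr_gt0 // expR_gt0.
Qed.

Let c_gt0 j : 0 < c j.
Proof. by rewrite mulr_gt0 // ltr_wpDl ?ler0n. Qed.

Let window_le (k p : nat) : (k <= p)%N ->
  gauss_fun (p%:R * delta) * (F (c k) - F ((k%:R - 2^-1) * delta)) <=
  gauss_fun (k%:R * delta) * (F (c p) - F ((p%:R - 2^-1) * delta)).
Proof.
move=> kp; rewrite /c !mulrDl !mulNr.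
apply: gauss_window_le => //.
- by rewrite mulr_ge0 ?ler0n // ltW.
- by rewrite ler_wpM2r ?ler_nat // ltW.
- by rewrite mulr_ge0 // ltW.
Qed.

(** Sum of [window_le] over the cells [|k| <= j] with [p] fixed: the integrals telescope to
    [F (c j) - F (- c j) = 2 * F (c j)]. *)
Let gauss_sum_window_le (j p : nat) : (j <= p)%N ->
  gauss_fun (p%:R * delta) * (2 * F (c j)) <=
  S j * (F (c p) - F ((p%:R - 2^-1) * delta)).
Proof.
elim: j => [|j IHj] jp.
  have := window_le (leq0n p).
  rewrite sub0r mulNr FN opprK S0 mul0r {2}/gauss_fun expr0n oppr0 expR0.
  by rewrite /c add0r -mulr2n -[F _ *+ 2]mulr_natl.
have := window_le jp; have := IHj (ltnW jp).
rewrite (_ : (j.+1%:R - 2^-1) * delta = c j); last first.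
  by rewrite /c -natr1; field.
rewrite SS; lra.
Qed.

(** Take [p = j.+1] above: that cell starts at [c j], so its integral is [F (c j.+1) - F (c j)]. *)
Let gauss_sum_ratio_step j : S j.+1 * F (c j) <= S j * F (c j.+1).
Proof.
have := gauss_sum_window_le (leqnSn j).
rewrite (_ : (j.+1%:R - 2^-1) * delta = c j); last first.
  by rewrite /c -natr1; field.
rewrite SS; lra.
Qed.

Lemma gauss_sum_ratio_le (j m : nat) : (j <= m)%N ->
  S m * F (c j) <= S j * F (c m).
Proof.
have F0 k : 0 < F (c k) by exact: primitive_gt0.
elim: m => [|m IHm]; first by rewrite leqn0 => /eqP ->.
rewrite leq_eqVlt ltnS => /orP[/eqP -> //|jm].
(* Cross-multiplied ratios chain through the positive intermediate value [F (c m)]. *)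
rewrite -(ler_pM2r (F0 m)) mulrAC.
apply: le_trans (ler_wpM2r (ltW (F0 j)) (gauss_sum_ratio_step m)) _.
by rewrite mulrAC [leRHS]mulrAC ler_wpM2r ?IHm // ltW.
Qed.

End GaussSum.

(** The primitive is only an intermediary: the squared ratio bound on the sums and
    [primitive_sqr_ratio_le] are multiplied, and [F (c m) ^+ 2] cancels. *)
Lemma gauss_sum_sqr_le (R : realType) (delta : R) (j m : nat) :
  0 < delta -> (j <= m)%N ->
  gauss_sum delta m ^+ 2 *
    (1 - gauss_fun ((j%:R + 2^-1) * delta)) <=
  gauss_sum delta j ^+ 2 *
    (1 - gauss_fun ((m%:R + 2^-1) * delta)).
Proof.
move=> d0 jm; have [F dF FN] := gauss_primitive R.
have cp k : 0 < (k%:R + 2^-1) * delta.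
  by rewrite mulr_gt0 // ltr_wpDl ?ler0n.
have cjm : (j%:R + 2^-1) * delta <= (m%:R + 2^-1) * delta.
  by rewrite ler_wpM2r ?(ltW d0) // lerD2r ler_nat.
have := gauss_sum_ratio_le dF FN d0 jm.
have := primitive_sqr_ratio_le dF FN (cp j) cjm.
have := gauss_sum_gt0 delta m; have := gauss_sum_gt0 delta j.
have := gauss_fun_lt1 (cp m); have := gauss_fun_lt1 (cp j).
have := primitive_gt0 dF FN (cp m); have := primitive_gt0 dF FN (cp j).
move: (F _) (F _) (gauss_fun _) (gauss_fun _) => Fm Fj gm gj.
move: (gauss_sum delta m) (gauss_sum delta j) => Sm Sj.
move=> Fj0 Fm0 gj1 gm1 Sj0 Sm0 hF hS.
rewrite -(@ler_pM2r _ (Fm ^+ 2)) ?exprn_gt0 //.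
have hS2 : (Sm * Fj) ^+ 2 <= (Sj * Fm) ^+ 2.
  by rewrite ler_sqr ?nnegrE ?(ltW (mulr_gt0 _ _)).
apply: (@le_trans _ _ (Sm ^+ 2 * (Fj ^+ 2 * (1 - gm)))).
  by rewrite -mulrA ler_wpM2l ?sqr_ge0 // mulrC.
by rewrite mulrA -exprMn [leRHS]mulrAC -exprMn ler_wpM2r // subr_ge0 ltW.
Qed.

(** * Chords of the exponential, and the logarithm of a mixture *)

Lemma expR_chord_le (R : realType) (th r : R) : 0 <= th <= 1 ->
  expR (th * r) <= 1 + th * (expR r - 1).
Proof.
move=> /andP[th0 th1].
have e0 : 0 <= expR (th * r) by exact: expR_ge0.
(* [h1] and [h2] evaluate the tangent of exp at [th * r] at the points [r] and 0; weights [th] and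
   [1 - th] then give the chord. *)
have h1 : expR (th * r) * (1 + (1 - th) * r) <= expR r.
  have -> : expR r = expR (th * r) * expR ((1 - th) * r).
    by rewrite -expRD; congr expR; ring.
  by rewrite ler_wpM2l // expR_ge1Dx.
have h2 : expR (th * r) * (1 - th * r) <= 1.
  rewrite -[leRHS](_ : expR (th * r) * expR (- (th * r)) = 1).
    by rewrite ler_wpM2l // expR_ge1Dx.
  by rewrite -expRD subrr expR0.
have h3 : 0 <= 1 - th by rewrite subr_ge0.
have := ler_wpM2l th0 h1; have := ler_wpM2l h3 h2; lra.
Qed.

(** Strictness comes from the tangent evaluated at 0, which differs from the contact point
    [th * r]. *)
Lemma expR_chord_lt (R : realType) (th r : R) : 0 < th < 1 -> r != 0 ->
  expR (th * r) < 1 + th * (expR r - 1).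
Proof.
move=> /andP[th0 th1] r0.
have e0 : 0 < expR (th * r) by exact: expR_gt0.
have h1 : expR (th * r) * (1 + (1 - th) * r) <= expR r.
  have -> : expR r = expR (th * r) * expR ((1 - th) * r).
    by rewrite -expRD; congr expR; ring.
  by rewrite ler_wpM2l ?(ltW e0) // expR_ge1Dx.
have h2 : expR (th * r) * (1 - th * r) < 1.
  rewrite -[ltRHS](_ : expR (th * r) * expR (- (th * r)) = 1).
    by rewrite ltr_pM2l // expR_gt1Dx // oppr_eq0 mulf_neq0 // lt0r_neq0.
  by rewrite -expRD subrr expR0.
have h3 : 0 < 1 - th by rewrite subr_gt0.
by have := ler_wpM2l (ltW th0) h1; move: h2; rewrite -(ltr_pM2l h3); lra.
Qed.

Section LnMix.
Variables (R : realType) (u : R).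
Hypothesis u01 : 0 <= u <= 1.

(** Average of 1 and [expR (- y)] with weights [1 - u] and [u]: the Laplace transform of a Bernoulli
    variable. *)
Definition exp_mix (y : R) : R := 1 - u * (1 - expR (- y)).

Lemma exp_mix_ge (y : R) : 0 <= y -> expR (- y) <= exp_mix y.
Proof.
move=> y0; have : expR (- y) <= 1 by rewrite expR_le1 oppr_le0.
move/andP: u01 => [u0 u1] e1.
have : 0 <= (1 - u) * (1 - expR (- y)) by rewrite mulr_ge0 // subr_ge0.
rewrite /exp_mix; lra.
Qed.

Lemma exp_mix_gt0 (y : R) : 0 <= y -> 0 < exp_mix y.
Proof. by move=> /exp_mix_ge; apply: lt_le_trans; exact: expR_gt0. Qed.

Lemma exp_mix_le1 (y : R) : 0 <= y -> exp_mix y <= 1.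
Proof.
move=> y0; rewrite /exp_mix gerBl; have /andP[u0 _] := u01.
by rewrite mulr_ge0 // subr_ge0 expR_le1 oppr_le0.
Qed.

Let exp_mixE (y : R) : 0 <= y -> exp_mix y = expR (ln (exp_mix y)).
Proof. by move=> y0; rewrite lnK // posrE exp_mix_gt0. Qed.

(** Dividing both terms of the mixture by [exp_mix y] makes their average 1, hence so is the average
    of the chords from 1 to them. *)
Let mixE (y th : R) : 0 <= y ->
  (1 - u) * (1 + th * (expR (- ln (exp_mix y)) - 1)) +
  u * (1 + th * (expR (- y - ln (exp_mix y)) - 1)) = 1.
Proof.
move=> y0; rewrite expRD expRN -exp_mixE //.
have := lt0r_neq0 (exp_mix_gt0 y0).
rewrite /exp_mix; move: (expR (- y)) => z z0; field.
exact: z0.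
Qed.

Let exp_mixM (y th : R) : exp_mix (th * y) = expR (th * ln (exp_mix y)) *
  ((1 - u) * expR (th * (- ln (exp_mix y))) +
   u * expR (th * (- y - ln (exp_mix y)))).
Proof.
rewrite mulrDr mulrCA -expRD [X in _ + X]mulrCA -expRD.
rewrite mulrN subrr expR0 addrC /exp_mix.
have -> : th * ln (exp_mix y) + th * (- y - ln (exp_mix y)) = - (th * y).
  by ring.
by ring.
Qed.

(** Jensen's inequality for the power [th]: factor the mixture by [exp_mixM], bound each normalised
    term by its chord, and conclude by [mixE]. *)
Lemma ln_exp_mix_le (y th : R) : 0 <= y -> 0 <= th <= 1 ->
  ln (exp_mix (th * y)) <= th * ln (exp_mix y).
Proof.
move=> y0 th01; have /andP[th0 th1] := th01; have /andP[u0 u1] := u01.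
have ty0 : 0 <= th * y by rewrite mulr_ge0.
rewrite -ler_expR -exp_mixE // exp_mixM.
rewrite -[leRHS]mulr1 ler_wpM2l ?expR_ge0 //.
rewrite -[leRHS](mixE th y0) lerD //.
  by rewrite ler_wpM2l ?subr_ge0 // expR_chord_le.
by rewrite ler_wpM2l // expR_chord_le.
Qed.

Lemma ln_exp_mix_lt (y th : R) : 0 < u < 1 -> 0 < y -> 0 < th < 1 ->
  ln (exp_mix (th * y)) < th * ln (exp_mix y).
Proof.
move=> /andP[u0 u1] y0 th01; have /andP[th0 th1] := th01.
have ty0 : 0 <= th * y by rewrite mulr_ge0 // ltW.
rewrite -ltr_expR -exp_mixE // exp_mixM.
rewrite -[ltRHS]mulr1 ltr_pM2l ?expR_gt0 //.
rewrite -[ltRHS](mixE th (ltW y0)) ltr_leD //.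
  (* The term of weight [1 - u] is strict, because [exp_mix y < 1] makes its exponent nonzero. *)
  rewrite ltr_pM2l ?subr_gt0 // expR_chord_lt // oppr_eq0.
  rewrite lt_eqF // ln_lt0 // exp_mix_gt0 ?(ltW y0) //=.
  by rewrite /exp_mix gtrBl mulr_gt0 // subr_gt0 expR_lt1 oppr_lt0.
by rewrite ler_wpM2l ?(ltW u0) // expR_chord_le // !ltW.
Qed.

End LnMix.

(** * From point masses to probabilities of events *)

Lemma prob_has_law (R : realType) (disp : measure_display)
    (T : measurableType disp) (P : probability T R) (X : {mfun T >-> R})
    (p : int -> R) (D : set int) (E : set R) :
  has_law (P := P) X p -> finite_set D -> \sum_(x \in D) p x = 1 ->
  measurable E ->
  P (X @^-1` E) = (\sum_(x \in D `&` [set x : int | E x%:~R]) p x)%:E.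
Proof.
move=> Xp finD pD mE.
have mX (B : set R) : measurable B -> measurable (X @^-1` B).
  by move=> mB; rewrite -[_ @^-1` _]setTI; exact: measurable_funP.
pose fib (x : int) : set T := X @^-1` [set x%:~R].
have mfib x : measurable (fib x) by exact: mX.
have PU (B : set int) : finite_set B ->
    P (\bigcup_(x in B) fib x) = (\sum_(x \in B) p x)%:E.
  move=> finB; rewrite measure_fin_bigcup //; last first.
    move=> x y _ _ [w [/= Xx Xy]].
    by have /eqP := etrans (esym Xx) Xy; rewrite eqr_int => /eqP.
  rewrite (fsbig_finite _ _ finB) /= (fsbig_finite _ _ finB) /= -sumEFin.
  apply: eq_bigr => x _; rewrite -Xp /pmf fineK //; exact: fin_num_measure.
have finDE : finite_set (D `&` [set x : int | E x%:~R]).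
  exact: finite_setIl.
have mU (B : set int) : finite_set B -> measurable (\bigcup_(x in B) fib x).
  by move=> finB; exact: fin_bigcup_measurable.
rewrite -PU //; apply/eqP; rewrite eq_le; apply/andP; split; last first.
  apply: le_measure; rewrite ?inE //; [exact: mU|exact: mX|].
  by move=> w [x [_ Ex] /= ->].
(* The masses on [D] sum to 1, so [X] avoids [D] with probability 0; thus the preimage of [E] is
   covered by its fibres over [D] and a null set. *)
have nullU : P (~` \bigcup_(x in D) fib x) = 0%E.
  by rewrite probability_setC ?PU ?pD ?subee //; exact: mU.
rewrite -[leRHS]adde0 -nullU.
apply: le_trans (measureU2 _ _ _); [|exact: mU|apply: measurableC; exact: mU].
apply: le_measure; rewrite ?inE //; first exact: mX.
  by apply: measurableU; [exact: mU|apply: measurableC; exact: mU].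
move=> w Ew; have [[x Dx wx]|nw] := pselect ((\bigcup_(x in D) fib x) w).
  by left; exists x => //; split=> //=; rewrite -wx.
by right.
Qed.

(** Oddness gives the symmetry: for even [q] the point [-q/2] has no opposite in the range. *)
Lemma Zq_int_ball (q : nat) : odd q -> Zq q = int_ball q./2.
Proof.
move=> oq; have := odd_double_half q; rewrite oq => qE.
by apply/seteqP; split=> x; rewrite /Zq /int_ball /=; lia.
Qed.

Section Laws.
Variable R : realType.

Lemma fsbig_uniform_Zq (q j : nat) : odd q -> (j <= q./2)%N ->
  \sum_(x \in int_ball j) (uniform_Zq q x : R) = (2 * j + 1)%:R / q%:R.
Proof.
move=> oq jm; rewrite -card_int_ball mulr_fsuml.
apply: eq_fsbigr => x /set_mem xj; rewrite /uniform_Zq Zq_int_ball // mul1r.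
by rewrite mem_set //; exact: leq_trans xj jm.
Qed.

Lemma gauss_weightE (t x : R) : 0 < t ->
  gauss_weight 0 t x = gauss_fun (x * (Num.sqrt (2 * t))^-1).
Proof.
move=> t0; rewrite /gauss_weight /gauss_fun subr0 exprMn exprVn sqr_sqrtr //.
by rewrite mulr_ge0 // ltW.
Qed.

Lemma fsbig_discrete_normal_Zq (q j : nat) (t : R) : odd q -> 0 < t ->
  (j <= q./2)%N ->
  \sum_(x \in int_ball j) discrete_normal (Zq q) 0 t x =
  gauss_sum (Num.sqrt (2 * t))^-1 j / gauss_sum (Num.sqrt (2 * t))^-1 q./2.
Proof.
move=> oq t0 jm; rewrite /gauss_sum mulr_fsuml.
apply: eq_fsbigr => x /set_mem xj.
rewrite /discrete_normal Zq_int_ball // mem_set; last exact: leq_trans xj jm.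
rewrite gauss_weightE //; congr (_ / _).
rewrite esum_fset; last by move=> ? _; rewrite lee_fin expR_ge0.
  rewrite (fsbig_finite _ _ (finite_int_ball _)) /= sumEFin /=.
  rewrite (fsbig_finite _ _ (finite_int_ball _)) /=.
  by apply: eq_bigr => y _; rewrite gauss_weightE.
exact: finite_int_ball.
Qed.

End Laws.

(** * The bound as a function of the variance *)

Section Bound.
Variables (R : realType) (q v l : nat) (alpha : R).
Hypothesis q_gt0 : (0 < q)%N.
Hypothesis alpha01 : 0 <= alpha <= 1.

Let u : R := (1 - alpha) ^+ 2.
Let k : R := 4 / (const_a R * q%:R ^+ 2).
Let B : R := const_b R * const_Q R q v l ^+ 2 / 4.

Let u01 : 0 <= u <= 1.
Proof.
have /andP[a0 a1] := alpha01.
by rewrite /u sqr_ge0 /= expr_le1 // ?subr_ge0 // gerBl.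
Qed.

Let k_gt0 : 0 < k.
Proof. by rewrite /k /const_a divr_gt0 // mulr_gt0 // exprn_gt0 // ltr0n. Qed.

Lemma const_Q_gt0 : 0 < const_Q R q v l.
Proof.
by rewrite /const_Q ltr_wpDl // mulr_ge0 ?ler0n // mulr_ge0 // sqr_ge0.
Qed.

Let B_gt0 : 0 < B.
Proof.
rewrite /B /const_b divr_gt0 // mulr_gt0 ?exprn_gt0 ?const_Q_gt0 //.
by rewrite divr_gt0 // pi_gt0.
Qed.

Let B_ge0 : 0 <= B.
Proof. exact: ltW. Qed.

Let boundE (t : R) :
  typeII_sq_bound q v l alpha t = k * (t * - ln (exp_mix u (B / t))).
Proof.
rewrite /typeII_sq_bound /exp_mix -/u.
have -> : const_b R * const_Q R q v l ^+ 2 / (4 * t) = B / t.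
  by rewrite /B invfM mulrA.
by rewrite /k; ring.
Qed.

(** By [exp_mix_ge], [- ln (exp_mix u y) <= y]; at [y = B / t] the factor [t] cancels. *)
Lemma typeII_sq_bound_le_cst (t : R) : 0 < t ->
  0 <= typeII_sq_bound q v l alpha t <= k * B.
Proof.
move=> t0; have Bt : 0 <= B / t by rewrite divr_ge0 // ltW.
rewrite boundE; apply/andP; split.
  rewrite mulr_ge0 ?(ltW k_gt0) // mulr_ge0 ?(ltW t0) // oppr_ge0.
  by rewrite ln_le0 // exp_mix_le1.
rewrite ler_wpM2l ?(ltW k_gt0) // mulrC -ler_pdivlMr // lerNl.
by rewrite -ler_expR lnK ?posrE ?exp_mix_gt0 // exp_mix_ge.
Qed.

Lemma typeII_sq_bound_le (s t : R) : 0 < s -> s <= t ->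
  typeII_sq_bound q v l alpha s <= typeII_sq_bound q v l alpha t.
Proof.
move=> s0 st; have t0 := lt_le_trans s0 st.
rewrite !boundE ler_wpM2l ?(ltW k_gt0) // !mulrN lerN2.
(* The contraction factor for [ln_exp_mix_le] is [th = s / t]. *)
have -> : B / t = s / t * (B / s) by field; rewrite !lt0r_neq0.
rewrite mulrC -ler_pdivlMr // [leRHS]mulrAC; apply: ln_exp_mix_le => //.
  by rewrite divr_ge0 // ltW.
by rewrite divr_ge0 ?(ltW s0) ?(ltW t0) //= ler_pdivrMr // mul1r.
Qed.

Lemma typeII_sq_bound_lt (s t : R) : 0 < alpha < 1 -> 0 < s -> s < t ->
  typeII_sq_bound q v l alpha s < typeII_sq_bound q v l alpha t.
Proof.
move=> /andP[a0 a1] s0 st; have t0 := lt_trans s0 st.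
rewrite !boundE ltr_pM2l // !mulrN ltrN2.
have -> : B / t = s / t * (B / s) by field; rewrite !lt0r_neq0.
rewrite mulrC -ltr_pdivlMr // [ltRHS]mulrAC; apply: ln_exp_mix_lt => //.
- by rewrite /u exprn_gt0 ?subr_gt0 //= expr_lt1 ?subr_ge0 ?ltW // gtrBl.
- by rewrite divr_gt0.
- by rewrite divr_gt0 //= ltr_pdivrMr // mul1r.
Qed.

Lemma typeII_bound_le (s t : R) : 0 < s -> s <= t ->
  typeII_bound q v l alpha s <= typeII_bound q v l alpha t.
Proof. by move=> s0 st; apply: ler_wsqrtr; exact: typeII_sq_bound_le. Qed.

Lemma typeII_bound_lt (s t : R) : 0 < alpha < 1 -> 0 < s -> s < t ->
  typeII_bound q v l alpha s < typeII_bound q v l alpha t.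
Proof.
move=> a01 s0 st; have lt_st := typeII_sq_bound_lt a01 s0 st.
rewrite /typeII_bound ltr_sqrt //; apply: le_lt_trans lt_st.
by have /andP[] := typeII_sq_bound_le_cst s0.
Qed.

(** The numerator stays below [Num.sqrt (k * B)], so the quotient is squeezed. *)
Lemma typeII_bound_sublinear :
  typeII_bound q v l alpha t / t @[t --> +oo] --> (0 : R).
Proof.
have V0 : (Num.sqrt (k * B) * t^-1) @[t --> +oo] --> (0 : R).
  rewrite -[X in _ --> X](mulr0 (Num.sqrt (k * B))); apply: cvgM.
    exact: cvg_cst.
  apply/gtr0_cvgV0; last exact: cvg_id.
  by near=> t; near: t; exact: nbhs_pinfty_gt.
apply: (@squeeze_cvgr _ _ _ _ (cst 0) (fun t => Num.sqrt (k * B) * t^-1)) => //;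
  last exact: cvg_cst.
near=> t; have t0 : 0 < t by near: t; exact: nbhs_pinfty_gt.
have /andP[b0 bC] := typeII_sq_bound_le_cst t0.
rewrite /= divr_ge0 ?sqrtr_ge0 ?(ltW t0) //= ler_wpM2r ?invr_ge0 ?(ltW t0) //.
exact: ler_wsqrtr.
Unshelve. all: by end_near. Qed.

(** Taking logarithms solves the hypothesis for [beta]; the 8 is [4 / a] with [a = 1 / 2]. *)
Lemma le_typeII_sq_bound (beta t : R) : 0 < t ->
  1 - expR (- ((q%:R * beta) ^+ 2 / (8 * t))) <=
    (1 - alpha) ^+ 2 *
      (1 - expR (- (const_b R * const_Q R q v l ^+ 2 / (4 * t)))) ->
  beta ^+ 2 <= typeII_sq_bound q v l alpha t.
Proof.
move=> t0 h; have q0 : 0 < q%:R :> R by rewrite ltr0n.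
have Bt : 0 <= B / t by rewrite divr_ge0 // ltW.
have BtE : const_b R * const_Q R q v l ^+ 2 / (4 * t) = B / t.
  by rewrite /B invfM mulrA.
have hmix : exp_mix u (B / t) <= expR (- ((q%:R * beta) ^+ 2 / (8 * t))).
  by move: h; rewrite BtE -/u /exp_mix; lra.
have hln : ln (exp_mix u (B / t)) <= - ((q%:R * beta) ^+ 2 / (8 * t)).
  by rewrite -ler_expR lnK // posrE exp_mix_gt0.
have -> : beta ^+ 2 = k * (t * ((q%:R * beta) ^+ 2 / (8 * t))).
  by rewrite /k /const_a; field; rewrite !lt0r_neq0.
rewrite boundE ler_wpM2l ?(ltW k_gt0) // ler_wpM2l ?(ltW t0) //.
by rewrite lerNr.
Qed.

End Bound.

(** * Comparison of the constants, and the conclusion *)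

Lemma const_Q_ge (R : realType) (q v l : nat) : odd q -> (1 < q)%N ->
  (1 <= l)%N -> q%:R <= const_Q R q v l.
Proof.
move=> oq q1 l1; have := odd_double_half q; rewrite oq => qE.
have m1 : 1 <= q./2%:R :> R by rewrite ler1n; lia.
have vl1 : 1 <= (v + l)%:R :> R by rewrite ler1n; lia.
have qR : q%:R = 1 + 2 * q./2%:R :> R.
  by rewrite -{1}qE natrD -muln2 natrM mulrC.
rewrite /const_Q qR; move: m1 vl1; move: (q./2%:R) ((v + l)%:R) => m w m1 w1.
have -> : (1 + 2 * m - 1) / 2 = m by field.
(* With [m, w >= 1]: [2 * m ^+ 2 * w + 1 >= 2 * m + 1]. *)
have : m * 1 <= m * m by rewrite ler_wpM2l // (le_trans ler01).
have : m ^+ 2 * 1 <= m ^+ 2 * w by rewrite ler_wpM2l // sqr_ge0.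
rewrite expr2; nra.
Qed.

(** For this [delta], [c_j ^+ 2 = (2 * j + 1) ^+ 2 / (8 * t)], which is [q ^+ 2 / (8 * t)] at
    [j = q./2]. Replacing [q ^+ 2] by the larger [4 / pi * Q ^+ 2] gives the stated exponent. *)
Lemma gauss_ratio_exp_le (R : realType) (q v l j : nat) (t : R) :
  odd q -> (1 < q)%N -> (1 <= l)%N -> 0 < t -> (j <= q./2)%N ->
  1 - expR (- ((2 * j + 1)%:R ^+ 2 / (8 * t))) <=
  (gauss_sum (Num.sqrt (2 * t))^-1 j /
     gauss_sum (Num.sqrt (2 * t))^-1 q./2) ^+ 2 *
    (1 - expR (- (const_b R * const_Q R q v l ^+ 2 / (4 * t)))).
Proof.
move=> oq q1 l1 t0 jm; set delta := (Num.sqrt (2 * t))^-1.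
have d0 : 0 < delta by rewrite invr_gt0 sqrtr_gt0 mulr_gt0.
have gE (i : nat) : gauss_fun ((i%:R + 2^-1) * delta) =
    expR (- ((2 * i + 1)%:R ^+ 2 / (8 * t))).
  rewrite /gauss_fun exprMn exprVn sqr_sqrtr ?mulr_ge0 ?(ltW t0) //.
  by congr expR; rewrite natrD natrM; field; rewrite lt0r_neq0.
have := gauss_sum_sqr_le d0 jm; rewrite !gE.
have Sm0 : 0 < gauss_sum delta q./2 by exact: gauss_sum_gt0.
have -> : (2 * q./2 + 1 = q)%N by have := odd_double_half q; rewrite oq; lia.
move=> h.
rewrite expr_div_n [leRHS]mulrAC ler_pdivlMr ?exprn_gt0 // [leLHS]mulrC.
apply: le_trans h _; rewrite ler_wpM2l ?sqr_ge0 // lerD2l lerN2 ler_expR lerN2.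
have pi4 : pi <= 4 :> R by have := @pihalf_lt2 R; lra.
have pi0 : 0 < pi :> R := pi_gt0 R.
have q0 : 0 <= q%:R :> R by rewrite ler0n.
have Qq : q%:R ^+ 2 <= const_Q R q v l ^+ 2.
  have Qq := const_Q_ge R v oq q1 l1.
  by rewrite ler_sqr ?nnegrE ?(le_trans q0 Qq).
have -> : const_b R * const_Q R q v l ^+ 2 / (4 * t) =
    (const_Q R q v l ^+ 2 * (4 / pi)) / (8 * t).
  rewrite /const_b; move: (@pi R) pi0 => p p0; field; rewrite !lt0r_neq0 //.
rewrite ler_wpM2r ?invr_ge0 ?mulr_ge0 ?(ltW t0) //.
apply: le_trans Qq _; rewrite -[leLHS]mulr1 ler_wpM2l ?sqr_ge0 //.
by rewrite ler_pdivlMr // mul1r.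
Qed.

Theorem theorem2 (R : realType)
  (q : nat) (q_prime : prime q) (q_odd : odd q)
  (n v k l : nat) (l_ge1 : (1 <= l)%N)
  (Prho : 'M[int]_(n, v)) (Tc : 'M[int]_(n, k)) (d : 'cV[int]_n)
  (d_filter : filtering_vector q Prho d)
  (d_support : #|[set i : 'I_n | d i 0 != 0]%SET| = (v + l)%N)
  (sigma : R) (sigma_gt0 : 0 < sigma)
  (Om : R -> R)
  (noise : noise_variance_assumption q (norm2 (Tc^T *m d)) Om (sigma ^+ 2))
  (tsigma2 : R) (tsigma2E : tsigma2 = sigma ^+ 2 * norm2 (Tc^T *m d) ^+ 2)
  (disp : measure_display) (T : measurableType disp)
  (P0 P1 : probability T R) (X : {mfun T >-> R})
  (H0 : has_law (P := P0) X (discrete_normal (Zq q) 0 tsigma2))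
  (H1 : has_law (P := P1) X (uniform_Zq q))
  (gamma alpha beta : R)
  (typeI : P0 [set w | gamma <= `|X w|] = alpha%:E)
  (typeII : P1 [set w | ~ (gamma <= `|X w|)] = beta%:E) :
  [/\ beta ^+ 2 <= typeII_sq_bound q v l alpha tsigma2,
      forall s t : R, 0 < s -> s <= t ->
        typeII_bound q v l alpha s <= typeII_bound q v l alpha t,
      0 < alpha < 1 -> forall s t : R, 0 < s -> s < t ->
        typeII_bound q v l alpha s < typeII_bound q v l alpha t &
      typeII_bound q v l alpha t / t @[t --> +oo] --> (0 : R)].
Proof.
set c := norm2 _ in noise tsigma2E.
have t0 : 0 < tsigma2.
  rewrite tsigma2E mulr_gt0 ?exprn_gt0 // lt0r sqrtr_ge0 andbT.
  (* A zero norm would make [variance_upper] equal to 0, as [0^-1 = 0], leaving no room for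
     [sigma ^+ 2] below it. *)
  apply/eqP => c0; have [_ [eps _ /andP[_]]] := noise.
  rewrite /variance_upper -/c c0 expr0n invr0 !mulr0 ltNge.
  by rewrite sqr_ge0.
have q0 : (0 < q)%N := prime_gt0 q_prime.
have q1 : (1 < q)%N := prime_gt1 q_prime.
pose E := [set x : R | `|x| < gamma].
have mE : measurable E.
  rewrite (_ : E = `]-gamma, gamma[%classic); first exact: measurable_itv.
  by apply/seteqP; split=> x; rewrite /E /= in_itv /= ltr_norml.
have finD := finite_int_ball q./2.
have qE : (2 * q./2 + 1 = q)%N.
  by have := odd_double_half q; rewrite q_odd; lia.
have tot0 :
    \sum_(x \in int_ball q./2) discrete_normal (Zq q) 0 tsigma2 x = 1.
  rewrite fsbig_discrete_normal_Zq // divff // lt0r_neq0 //.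
  exact: gauss_sum_gt0.
have tot1 : \sum_(x \in int_ball q./2) (uniform_Zq q x : R) = 1.
  by rewrite fsbig_uniform_Zq // qE divff // pnatr_eq0 -lt0n.
(* The acceptance event has probability [1 - alpha] under [P0] and [beta] under [P1]; both become
   finite sums. *)
have := prob_has_law H0 finD tot0 mE.
have := prob_has_law H1 finD tot1 mE.
have -> : X @^-1` E = [set w | ~ (gamma <= `|X w|)].
  by apply/seteqP; split=> w; rewrite /E /= ltNge => /negP.
rewrite typeII => -[betaE].
have -> : [set w | ~ (gamma <= `|X w|)] = ~` [set w | gamma <= `|X w|] by [].
have mI : measurable [set w | gamma <= `|X w|].
  rewrite (_ : [set w | _] = X @^-1` (~` E)); last first.
    by apply/seteqP; split=> w; rewrite /E /= leNgt => /negP.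
  rewrite -[_ @^-1` _]setTI; apply: measurable_funP => //.
  exact: measurableC.
rewrite probability_setC // typeI -EFinB => -[alphaE].
have alpha01 : 0 <= alpha <= 1.
  by rewrite -!lee_fin -typeI measure_ge0 probability_le1.
split.
- apply: le_typeII_sq_bound => //.
  (* For [gamma <= 0] nothing is accepted, and both sides vanish. *)
  have [g0|g0] := lerP gamma 0.
    have E0 : int_ball q./2 `&` [set x : int | E x%:~R] = set0.
      apply/seteqP; split=> // x [_]; rewrite /E /= => xg.
      by have := lt_le_trans xg g0; rewrite normr_lt0.
    rewrite betaE alphaE E0 !fsbig_set0.
    by rewrite mulr0 expr0n mul0r oppr0 expR0 subrr mul0r.
  have [j jm Ej] := int_ball_lt_real q./2 g0.
  move: betaE alphaE.
  rewrite Ej fsbig_uniform_Zq // fsbig_discrete_normal_Zq //.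
  (* Here [q * beta = 2 * j + 1], the number of accepted points. *)
  move=> -> ->; rewrite [q%:R * _]mulrC divfK ?pnatr_eq0 -?lt0n //.
  exact: gauss_ratio_exp_le.
- exact: typeII_bound_le.
- by move=> a01 s t; exact: typeII_bound_lt.
- exact: typeII_bound_sublinear.
Qed.
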